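(* Let $T$ be a tree and let $\varphi$ be a self-map of $T$. The bounded composition operator $C_\varphi$ is an isometry on $L^\infty$ if and only if $\varphi$ is surjective.
   Context: A tree $T$ is a locally finite, connected, simply-connected graph, identified as a set with its set of vertices; it is assumed to have no terminal vertices (a vertex is terminal if it has a unique neighbor), hence to be infinite, and it is rooted at a vertex $o$. A function on $T$ is a complex-valued function on the set of vertices. $L^\infty$ is the Banach space of all bounded functions $f$ on $T$, with norm $\|f\|_\infty = \sup_{v \in T} |f(v)|$. For an arbitrary self-map $\varphi$ of (the vertex set of) $T$, the composition operator is $C_\varphi f = f \circ \varphi$. It is an isometry on $L^\infty$ if $\|C_\varphi f\|_\infty = \|f\|_\infty$ for all $f \in L^\infty$ (surjectivity of $C_\varphi$ is not required). *)

(* Defs.v *)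
From HB Require Import structures.
From mathcomp Require Import all_boot all_order all_algebra.
From mathcomp Require Import complex.
From mathcomp Require Import all_classical all_reals all_analysis.

Set Implicit Arguments.
Unset Strict Implicit.
Unset Printing Implicit Defensive.

Import Order.TTheory GRing.Theory Num.Theory.
Import numFieldNormedType.Exports.

Local Open Scope classical_set_scope.
Local Open Scope ring_scope.
Local Open Scope complex_scope.

Definition terminal (V : choiceType) (adj : rel V) (v : V) : Prop :=
  exists w : V, [set u | adj v u] = [set w].

(* [adj_simply_connected] says that the graph has no circuit: a duplicate-free
   closed walk has at most two vertices (an edge walked back and forth).
   [tree_infinite] follows from the other fields, except that it rules out the
   one-vertex graph, whose vertex has no neighbour and so is not terminal. *)
Record rootedTree := RootedTree {
  vertex :> choiceType;
  adj : rel vertex;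
  root : vertex;
  adj_symmetric : symmetric adj;
  adj_irreflexive : irreflexive adj;
  adj_locally_finite : forall v, finite_set [set u | adj v u];
  adj_connected : forall v w, exists2 p, path adj v p & last v p = w;
  adj_simply_connected : forall c, ucycle adj c -> (size c <= 2)%N;
  no_terminal : forall v, ~ terminal adj v;
  tree_infinite : infinite_set [set: vertex]
}.

Section bounded_functions.
Context (R : realType) (T : rootedTree).

Definition bounded_pred : {pred T -> R[i]} :=
  fun f => `[< bounded_fun (f : T -> R[i]^o) >].

Lemma bounded_predP (f : T -> R[i]) :
  reflect (exists M : R, forall v, Normc.normc (f v) <= M)
          (f \in bounded_pred).
Proof.
apply: (iffP idP) => [/asboolP[M [Mreal fM]]|[M fM]].
  have Mr : M = (complex.Re M)%:C by rewrite RRe_real.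
  exists (complex.Re M + 1) => v.
  have := fM (complex.Re M + 1)%:C _ v I.
  rewrite {1}Mr ltcR ltrDl ltr01 => /(_ isT) /=.
  by rewrite -lecR.
apply/asboolP; exists M%:C; split; first by rewrite complex_real.
move=> x Mx v _; apply: le_trans (ltW Mx).
by have := fM v; rewrite -lecR.
Qed.

Fact bounded_pred_submod : submod_closed bounded_pred.
Proof.
split=> [|a f g /bounded_predP[M fM] /bounded_predP[N gN]].
  by apply/bounded_predP; exists 0 => v; rewrite Normc.normc0.
apply/bounded_predP; exists (Normc.normc a * M + N) => v.
apply: le_trans (le_normcD _ _) _; apply: lerD (gN v).
have /= -> := Normc.normcM a (f v).
apply: ler_wpM2l (fM v).
by case: (a) => x y; exact: sqrtr_ge0.
Qed.

HB.instance Definition _ :=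
  GRing.isSubmodClosed.Build R[i] (T -> R[i]) bounded_pred bounded_pred_submod.

Record Linfty := BoundedFun {
  Linfty_fun :> T -> R[i];
  Linfty_bounded : Linfty_fun \in bounded_pred
}.

HB.instance Definition _ := [isSub for Linfty_fun].
HB.instance Definition _ := [Choice of Linfty by <:].
HB.instance Definition _ := [SubChoice_isSubLmodule of Linfty by <:].

Definition sup_norm (f : Linfty) : R :=
  sup [set Normc.normc (f v) | v in [set: T]].

Implicit Types f g : Linfty.

Lemma normc_le_sup_norm f v : Normc.normc (f v) <= sup_norm f.
Proof.
apply: ub_le_sup; last by exists v.
have /bounded_predP[M fM] := Linfty_bounded f.
by exists M => _ [w _ <-].
Qed.

Lemma sup_norm_le f (M : R) :
  (forall v, Normc.normc (f v) <= M) -> sup_norm f <= M.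
Proof.
move=> fM; apply: ge_sup; first by exists (Normc.normc (f (root T))), (root T).
by move=> _ [v _ <-].
Qed.

Lemma sup_norm_ge0 f : 0 <= sup_norm f.
Proof.
apply: le_trans (normc_le_sup_norm f (root T)).
by case: (f _) => x y; exact: sqrtr_ge0.
Qed.

Fact sup_normD f g : (sup_norm (f + g))%:C <= (sup_norm f)%:C + (sup_norm g)%:C.
Proof.
rewrite -rmorphD lecR; apply: sup_norm_le => v.
by apply: le_trans (le_normcD _ _) _; apply: lerD; exact: normc_le_sup_norm.
Qed.

Lemma sup_normZ_le (a : R[i]) f :
  sup_norm (a *: f) <= Normc.normc a * sup_norm f.
Proof.
apply: sup_norm_le => v; have /= -> := Normc.normcM a (f v).
apply: ler_wpM2l (normc_le_sup_norm f v).
by case: (a) => x y; exact: sqrtr_ge0.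
Qed.

Fact sup_normZ (a : R[i]) f : (sup_norm (a *: f))%:C = `|a| * (sup_norm f)%:C.
Proof.
have -> : `|a| = (Normc.normc a)%:C by [].
rewrite -rmorphM; congr (_%:C); apply/eqP; rewrite eq_le sup_normZ_le /=.
have [->|a0] := eqVneq a 0.
  by rewrite Normc.normc0 mul0r; exact: sup_norm_ge0.
have na0 : 0 < Normc.normc a.
  by rewrite -ltcR; have := normr_gt0 a; rewrite a0.
have := sup_normZ_le a^-1 (a *: f).
by rewrite scalerA mulVf// scale1r Normc.normcV -ler_pdivlMl ?invr_gt0// invrK.
Qed.

Fact sup_norm_eq0 f : (sup_norm f)%:C = 0 -> f = 0.
Proof.
move=> /complexI f0; apply/val_inj/funext => v /=.
apply: Normc.eq0_normc; apply/eqP; rewrite eq_le.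
rewrite -[X in _ <= X]f0 normc_le_sup_norm /=.
by case: (f v) => x y; exact: sqrtr_ge0.
Qed.

(* The norm of a normed module over [R[i]] takes its values in [R[i]]: here
   `|f| is the real number [sup_norm f], embedded in [R[i]]. *)
HB.instance Definition _ :=
  @Lmodule_isNormed.Build R[i] Linfty (fun f => (sup_norm f)%:C)
    sup_normD sup_normZ sup_norm_eq0.

Lemma Linfty_normE f : `|f| = (sup_norm f)%:C.
Proof. by []. Qed.

End bounded_functions.

Section composition_operator.
Context (R : realType) (T : rootedTree) (phi : T -> T).
Implicit Types f : Linfty R T.

Fact comp_bounded f : (f : T -> R[i]) \o phi \in @bounded_pred R T.
Proof.
have /bounded_predP[M fM] := Linfty_bounded f.
by apply/bounded_predP; exists M => v; exact: fM.
Qed.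

Definition comp_op f : Linfty R T := BoundedFun (comp_bounded f).

Fact comp_op_is_linear : linear comp_op.
Proof. by move=> a f g; exact/val_inj. Qed.

HB.instance Definition _ :=
  GRing.isLinear.Build R[i] (Linfty R T) (Linfty R T) _ comp_op
    comp_op_is_linear.

Lemma comp_op_norm_le f : `|comp_op f| <= `|f|.
Proof.
by rewrite !Linfty_normE lecR; apply: sup_norm_le => v; exact: (normc_le_sup_norm f).
Qed.

Lemma comp_op_continuous : continuous comp_op.
Proof.
apply/linear_bounded_continuous/linear_boundedP.
near=> r => f; apply: le_trans (comp_op_norm_le f) _.
by apply: ler_peMl.
Unshelve. all: by end_near. Qed.

End composition_operator.

Definition norm_isometry (K : numFieldType) (U W : normedModType K) (F : U -> W) :
  Prop := forall f : U, `|F f| = `|f|.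

(* Main.v *)
Require Import Defs.
From mathcomp Require Import all_boot all_order all_algebra.
From mathcomp Require Import complex.
From mathcomp Require Import all_classical all_reals all_analysis.

(** The supremum norm sees a function only through its set of values.  If [phi]
    is surjective, then [f \o phi] has the same values as [f], hence the same
    norm.  Conversely, a linear isometry has trivial kernel; but if [phi] misses
    a vertex [w], the indicator of [w] is a nonzero bounded function that
    [comp_op phi] sends to [0]. *)

Import Order.TTheory GRing.Theory Num.Theory.
Local Open Scope ring_scope.

Lemma indicator_bounded (R : realType) (T : rootedTree) (w : T) :
  (fun v : T => ((v == w)%:R : R[i]%C)) \in @bounded_pred R T.
Proof.
apply/bounded_predP; exists 1 => v.
by case: (v == w); rewrite ?Normc.normc1 ?Normc.normc0.
Qed.

Definition indicator (R : realType) (T : rootedTree) (w : T) : Linfty R T :=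
  BoundedFun (indicator_bounded R T w).

Lemma indicator_neq0 (R : realType) (T : rootedTree) (w : T) :
  indicator R T w <> 0.
Proof.
move=> /(congr1 (fun f : Linfty R T => f w)) /=.
by rewrite eqxx; apply/eqP; exact: oner_neq0.
Qed.

Lemma comp_op_indicator_eq0 (R : realType) (T : rootedTree) (phi : T -> T)
    (w : T) :
  (forall v, phi v <> w) -> comp_op phi (indicator R T w) = 0.
Proof.
move=> phiw; apply/val_inj/funext => v /=.
by have /eqP/negbTE -> := phiw v.
Qed.

Lemma sup_norm_comp_surj (R : realType) (T : rootedTree) (phi : T -> T)
    (f : Linfty R T) :
  set_surj [set: T]%classic [set: T]%classic phi ->
  sup_norm (comp_op phi f) = sup_norm f.
Proof.
move=> phi_surj; apply/eqP; rewrite eq_le; apply/andP; split.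
  by apply: sup_norm_le => v; exact: (normc_le_sup_norm f).
apply: sup_norm_le => w; have [v _ <-] := phi_surj w I.
exact: (normc_le_sup_norm (comp_op phi f) v).
Qed.

Theorem corollary5p4 (R : realType) (T : rootedTree) (phi : T -> T) :
  norm_isometry (@comp_op R T phi) <->
  set_surj [set: T]%classic [set: T]%classic phi.
Proof.
split=> [isom w _|phi_surj f]; last first.
  by rewrite !Linfty_normE sup_norm_comp_surj.
apply: contrapT => w_missed; apply: (indicator_neq0 R T w).
apply/normr0_eq0; rewrite -isom comp_op_indicator_eq0 ?normr0// => v phivw.
by apply: w_missed; exists v.
Qed.
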